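(* Let $p>2$ be a prime and let $\varphi\in\mathbb{C}^{\{1,\ldots,p-1\}}$. Then the system $\widehat{\pi}_0(G)\varphi=(\widehat{\pi}_0(k,l)\varphi)_{(k,l)\in G}$ does matrix recovery on $\mathbb{C}^{\{1,\ldots,p-1\}}$ if and only if $\varphi$ fulfills both of the following conditions: (i) For every character $\chi\in\widehat{\mathbb{Z}_p^*}$, the number $$c_\varphi(\chi)=\sum_{l=1}^{p-1}|\varphi(-l)|^2\chi(l)$$ is nonzero. (ii) The matrix $B_\varphi\in\mathbb{C}^{\{1,\ldots,p-1\}\times\{1,\ldots,p-2\}}$ defined by $$B_\varphi(m,n)=\varphi(mn)\,\overline{\varphi(m(n+1))}$$ has a left inverse $B_\varphi^\dagger\in\mathbb{C}^{\{1,\ldots,p-2\}\times\{1,\ldots,p-1\}}$.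
   Context: All arithmetic on indices in $\{0,1,\ldots,p-1\}$ is in the field $\mathbb{Z}_p=\mathbb{Z}/p\mathbb{Z}$ (so e.g. $mn$, $-l$ are reduced modulo $p$). $\mathbb{Z}_p^*=\mathbb{Z}_p\setminus\{0\}$ is the multiplicative group, identified as a set with $\{1,\ldots,p-1\}$, and $\widehat{\mathbb{Z}_p^*}$ is the group of its characters, i.e. homomorphisms $\mathbb{Z}_p^*\to\mathbb{T}=\{z\in\mathbb{C}:|z|=1\}$. $G=\mathbb{Z}_p\rtimes\mathbb{Z}_p^*$ is the affine group: the set $\mathbb{Z}_p\times\mathbb{Z}_p^*$ with group law $(k,l)(k',l')=(k+lk',ll')$. For finite sets $X,Y$, $\mathbb{C}^{X\times Y}$ is the space of complex matrices with rows indexed by $X$ and columns indexed by $Y$. The unitary representation $\widehat{\pi}_0$ of $G$ acts on $\mathbb{C}^{\{1,\ldots,p-1\}}$ by $$(\widehat{\pi}_0(k,l)f)(m)=e^{-2\pi i km/p}f(lm).$$ A system $(\psi_i)_{i\in I}$ of vectors in a finite-dimensional complex Hilbert space $\mathcal{H}$ does matrix recovery if the linear map $A\mapsto(\langle A\psi_i,\psi_i\rangle)_{i\in I}$ from the space $\mathcal{L}(\mathcal{H})$ of linear maps $\mathcal{H}\to\mathcal{H}$ to $\mathbb{C}^I$ is one-to-one. *)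

(* Defs.v *)
From HB Require Import structures.
From mathcomp Require Import all_boot all_order all_fingroup all_algebra.
From mathcomp Require Import reals trigo ring.
From mathcomp Require Export complex.

Set Implicit Arguments.
Unset Strict Implicit.
Unset Printing Implicit Defensive.

Import Order.TTheory GRing.Theory Num.Theory.
Local Open Scope ring_scope.
Local Open Scope complex_scope.

(* C^X with its standard inner product, for a finite index set X; the regular
   module R[i]^o makes C act on itself by multiplication. *)
Notation cvec R X := {ffun X -> R[i]^o}.

Section MatrixRecovery.
Variables (R : realType) (X : finType).

Definition inner (f g : cvec R X) : R[i] :=
  \sum_(x : X) (f x : R[i]) * (g x : R[i])^*.

Definition does_matrix_recovery (I : finType) (psi : I -> cvec R X) : Prop :=
  injective (fun A : 'End(cvec R X) =>
    [ffun i : I => inner (A (psi i)) (psi i)]).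

End MatrixRecovery.

(* The index set {1, ..., p-1} is the unit group of 'F_p. *)
Notation Zpx p := {unit 'F_p}.

Section AffineGroup.
Variable p : nat.

Definition affine : Type := 'F_p * Zpx p.
HB.instance Definition _ := Finite.on affine.

Definition affine_one : affine := (0, 1%g).
Definition affine_mul (g h : affine) : affine :=
  (g.1 + val g.2 * h.1, (g.2 * h.2)%g).
Definition affine_inv (g : affine) : affine :=
  (- ((val g.2)^-1 * g.1), (g.2^-1)%g).

Fact affine_mulA : associative affine_mul.
Proof.
by move=> [a b] [c d] [e f]; congr pair; rewrite /= ?mulgA// mulrDr mulrA addrA.
Qed.

Fact affine_mul1 : left_id affine_one affine_mul.
Proof. by move=> [a b]; congr pair; rewrite /= ?mul1g// mul1r add0r. Qed.

Fact affine_mulV : left_inverse affine_one affine_inv affine_mul.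
Proof. by move=> [a b]; congr pair; rewrite /= ?mulVg// addrC subrr. Qed.

HB.instance Definition _ :=
  Finite_isGroup.Build affine affine_mulA affine_mul1 affine_mulV.

End AffineGroup.

Section Statement.
Variables (R : realType) (p : nat).
Local Notation C := R[i].

Definition expi (t : R) : C := cos t +i* sin t.

(* Elements of 'F_p are read as their representatives in {0, ..., p-1}. *)
Definition hpi0 (g : affine p) (f : cvec R (Zpx p)) : cvec R (Zpx p) :=
  [ffun m : Zpx p =>
    expi (- (2 * pi * ((g.1 : nat) * (val m : nat))%:R / p%:R))
      * (f (g.2 * m)%g : C)].

Definition is_character (chi : Zpx p -> C) : Prop :=
  (forall l l', chi (l * l')%g = chi l * chi l') /\ (forall l, `|chi l| = 1).

Fact neg_unit_subproof (l : Zpx p) : - val l \is a GRing.unit.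
Proof. by rewrite unitrN; exact: (valP l). Qed.
Definition neg_unit (l : Zpx p) : Zpx p := FinRing.Unit (neg_unit_subproof l).

Definition c_coef (phi : cvec R (Zpx p)) (chi : Zpx p -> C) : C :=
  \sum_(l : Zpx p) `|phi (neg_unit l) : C| ^+ 2 * chi l.

(* {1, ..., p-2}, as the n in Z_p^* for which n + 1 is again in Z_p^*
   (lemma colidxE), so that phi (m (n + 1)) makes sense. *)
Definition colidx : Type :=
  {n : Zpx p | val n + 1 \is a GRing.unit}.
HB.instance Definition _ := Finite.on colidx.

Definition succ_unit (n : colidx) : Zpx p := FinRing.Unit (valP n).

(* The library indexes matrices by ordinals: rows and columns are the
   enumerations of {1, ..., p-1} and {1, ..., p-2}. *)
Definition B_mx (phi : cvec R (Zpx p)) : 'M[C]_(#|{: Zpx p}|, #|{: colidx}|) :=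
  \matrix_(i, j)
    let m : Zpx p := enum_val i in
    let n : colidx := enum_val j in
    (phi (m * val n)%g : C) * (phi (m * succ_unit n)%g : C)^*.

End Statement.

Lemma affine_mulE (p : nat) (k k' : 'F_p) (l l' : Zpx p) :
  (((k, l) : affine p) * ((k', l') : affine p))%g = (k + val l * k', (l * l')%g).
Proof. by []. Qed.

Lemma colidxE (p : nat) (n : Zpx p) : prime p ->
  (val n + 1 \is a GRing.unit) = ((val n : nat) <= p - 2)%N.
Proof.
move=> pp; have ltnp : (val n < p)%N by rewrite -[X in (_ < X)%N](Fp_cast pp).
rewrite unitfE -[X in X + 1]natr_Zp -mulrSr.
rewrite -(dvdn_pcharf (pchar_Fp pp)).
have := prime_gt1 pp; move: (val n : nat) ltnp => /= k kp p1.
rewrite leq_subRL// add2n.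
have [->|np] := eqVneq k.+1 p; first by rewrite dvdnn ltnn.
by rewrite ltn_neqAle np kp /= gtnNdvd// ltn_neqAle np.
Qed.

Lemma expiD (R : realType) (s t : R) : expi (s + t) = expi s * expi t.
Proof. by rewrite /expi cosD sinD [X in _ +i* X]addrC. Qed.

Lemma expi_mod (R : realType) (p n : nat) : (0 < p)%N ->
  expi (- (2 * pi * (n %% p)%:R / p%:R)) =
  expi (- (2 * pi * n%:R / p%:R)) :> R[i].
Proof.
move=> p_gt0; have p0 : p%:R != 0 :> R by rewrite pnatr_eq0 -lt0n.
have per m : expi (- (2 * pi * m%:R)) = 1 :> R[i].
  elim: m => [|m IH]; first by rewrite mulr0 oppr0 /expi cos0 sin0.
  rewrite -(natr1 m) mulrDr opprD expiD IH mul1r mulr1 /expi cosN sinN.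
  by rewrite mulr_natl cos2pi sin2pi oppr0.
have -> : 2 * pi * n%:R / p%:R
    = 2 * pi * (n %/ p)%:R + 2 * pi * (n %% p)%:R / p%:R :> R.
  by rewrite [in LHS](divn_eq n p) (natrD _ (n %/ p * p)) natrM; field.
by rewrite opprD expiD per mul1r.
Qed.

Lemma hpi0M (R : realType) (p : nat) (g h : affine p) (f : cvec R (Zpx p)) :
  prime p -> hpi0 (g * h)%g f = hpi0 g (hpi0 h f).
Proof.
case: g h => [k l] [k' l'] pp; apply/ffunP => m; rewrite affine_mulE !ffunE /=.
rewrite -[LHS]/(expi _ * f _) -[RHS]/(expi _ * (expi _ * f _)).
rewrite [RHS]mulrA -expiD.
have -> : (l * l' * m = l' * (l * m))%g by apply: val_inj; rewrite /= mulrCA mulrA.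
congr (_ * _).
have valD (x y : 'F_p) : (x + y)%R = ((x + y) %% p)%N :> nat.
  by rewrite /= [X in (_ %% X)%N](Fp_cast pp).
have valM (x y : 'F_p) : (x * y)%R = ((x * y) %% p)%N :> nat.
  by rewrite /= [X in (_ %% X)%N](Fp_cast pp).
have E : ((k + val l * k')%R * val m = k * val m + k' * (val l * val m)%R
          %[mod p])%N.
  rewrite valD !valM modnDmr modnMml mulnDl -[RHS]modnDmr modnMmr modnDmr.
  by rewrite [(val l * k')%N]mulnC -mulnA.
rewrite -expi_mod ?prime_gt0// -opprD -mulrDl -mulrDr -natrD.
by rewrite -[RHS]expi_mod ?prime_gt0// -E.
Qed.

(* Main.v *)
From HB Require Import structures.
Require Import Defs.
From mathcomp Require Import all_boot all_order all_fingroup all_algebra.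
From mathcomp Require Import reals complex.
From mathcomp Require Import cyclic trigo ring lra.

Set Implicit Arguments.
Unset Strict Implicit.
Unset Printing Implicit Defensive.

Import Order.TTheory GRing.Theory Num.Theory.
Local Open Scope ring_scope.

(* Write an operator A through its kernel a(m,n). For fixed l, the measurement
   at (k,l) is, as a function of k, the Fourier transform on Z_p of
     d |-> sum_(n - m = d) a(m,n) phi(ln) conj(phi(lm)),
   so A is annihilated iff these sums vanish for all d and l: the diagonals of
   a decouple. On the main diagonal (d = 0) the condition says that the
   correlation of a(m,m) with |phi|^2 over Z_p^* vanishes, which forces
   a(m,m) = 0 iff no character coefficient of |phi|^2 is zero. On the diagonal
   d = -u with u a unit, the entries are a(u(c+1), uc), and the condition says
   that this vector in c is in the kernel of B_phi. *)

(** * Discrete Fourier transform and roots of unity *)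

Lemma dft_inj (F : fieldType) (N : nat) (w : F) (h : 'I_N -> F) :
  N.-primitive_root w ->
  (forall j : 'I_N, \sum_(i < N) h i * w ^+ (i * j) = 0) -> forall i, h i = 0.
Proof.
(* [q] is the polynomial with coefficients [h]. By hypothesis it vanishes at the N distinct powers
   of [w], too many roots for a nonzero polynomial of size at most N. *)
move=> wN hw i; pose q := \poly_(k < N) oapp h 0 (insub k).
have qE (k : 'I_N) : oapp h 0 (insub (val k)) = h k by rewrite valK.
have q0 : q = 0.
  apply/eqP/negPn/negP => qN0.
  have := @max_poly_roots _ q [seq w ^+ j | j : 'I_N] qN0.
  rewrite size_map -cardE card_ord => lt_size.
  suff /leq_trans/(_ (size_poly _ _)) : (N < size q)%N by rewrite ltnn.
  apply: lt_size.
    apply/allP => _ /mapP[j _ ->]; rewrite rootE horner_poly -[X in _ == X](hw j).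
    by apply/eqP/eq_bigr => k _; rewrite qE -exprM mulnC.
  rewrite map_inj_uniq ?enum_uniq// => j k /eqP.
  by rewrite (eq_prim_root_expr wN) !modn_small// => /eqP/val_inj.
rewrite -qE; have := coef_poly N (fun k => oapp h 0 (insub k)) i.
by rewrite -/q q0 coef0 ltn_ord.
Qed.

Section RootsOfUnity.
Variable R : realType.

Lemma expi_natE (N n : nat) :
  expi (- (2 * pi * n%:R / N%:R)) = expi (- (2 * pi / N%:R)) ^+ n :> R[i].
Proof.
elim: n => [|n IH]; first by rewrite mulr0 mul0r oppr0 /expi cos0 sin0.
by rewrite exprSr -IH -expiD -(natr1 n) mulrDr mulr1 mulrDl opprD.
Qed.

Lemma normr_expi (t : R) : `|expi t| = 1.
Proof. by rewrite normc_def /= cos2Dsin2 sqrtr1. Qed.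

Lemma expi_prim_root (N : nat) : (0 < N)%N ->
  N.-primitive_root (expi (- (2 * pi / N%:R)) : R[i]).
Proof.
move=> N0; have NR : N%:R != 0 :> R by rewrite pnatr_eq0 -lt0n.
rewrite /primitive_root_of_unity N0; apply/forallP => i; apply/eqP.
rewrite unity_rootE -expi_natE.
have [->|neN] := eqVneq i.+1 N.
  by rewrite mulfK// /expi cosN sinN mulr_natl cos2pi sin2pi oppr0; apply: eqxx.
have iN : (i.+1 < N)%N by rewrite ltn_neqAle neN /=.
apply/negbTE/negP => /eqP[].
(* Half the angle: if the power were 1, then [cos (x *+ 2) = 1] would force [sin x = 0], although x
   lies strictly between 0 and pi. *)
set x := i.+1%:R * pi / N%:R : R.
have -> : 2 * pi * i.+1%:R / N%:R = x *+ 2 :> R.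
  by rewrite -[RHS]mulr_natl /x -!mulrA [pi * (_ * _)]mulrCA.
rewrite cosN sinN cos_mulr2n => cos2 _; have := cos2Dsin2 x.
have -> : cos x ^+ 2 = 1 by lra.
rewrite -[RHS]addr0 => /addrI/eqP.
rewrite expf_eq0 /= gt_eqF// sin_gt0_pi// /x divr_gt0 ?mulr_gt0 ?pi_gt0 ?ltr0n//=.
by rewrite ltr_pdivrMr ?ltr0n// mulrC ltr_pM2l ?pi_gt0// ltr_nat.
Qed.

End RootsOfUnity.

(** * Operators and their kernels *)

Section MatrixRecovery.
Variables (R : realType) (X : finType).

Definition kernel_op_fun (a : X -> X -> R[i]) (f : cvec R X) : cvec R X :=
  [ffun m => \sum_n a m n * (f n : R[i])].

Fact kernel_op_linear (a : X -> X -> R[i]) : linear (kernel_op_fun a).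
Proof.
move=> c f g; apply/ffunP => m; rewrite !ffunE.
rewrite -[RHS]/(c * (\sum_n _) + _ : R[i]) mulr_sumr -big_split.
apply: eq_bigr => n _; rewrite !ffunE -[X in a m n * X]/(c * f n + g n : R[i]).
by rewrite mulrDr mulrCA.
Qed.

HB.instance Definition _ (a : X -> X -> R[i]) :=
  GRing.isLinear.Build R[i] (cvec R X) (cvec R X) _ (kernel_op_fun a)
    (kernel_op_linear a).

Lemma kernel_op_inner (a : X -> X -> R[i]) (f : cvec R X) :
  inner (kernel_op_fun a f) f =
  \sum_m \sum_n a m n * ((f n : R[i]) * (f m : R[i])^*).
Proof.
apply: eq_bigr => m _; rewrite ffunE mulr_suml.
by apply: eq_bigr => n _; rewrite mulrA.
Qed.

Definition kernel_of (A : 'End(cvec R X)) (m n : X) : R[i] :=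
  A [ffun k => (k == n)%:R] m.

Lemma kernel_ofK (A : 'End(cvec R X)) f : kernel_op_fun (kernel_of A) f = A f.
Proof.
have -> : f = \sum_n f n *: ([ffun k => (k == n)%:R] : cvec R X).
  apply/ffunP => m; rewrite sum_ffunE (bigD1 m)//= big1 => [|n nm].
    by rewrite addr0 !ffunE eqxx -[RHS]/(f m * 1 : R[i]) mulr1.
  by rewrite !ffunE eq_sym (negbTE nm) scaler0.
rewrite !linear_sum; apply: eq_bigr => n _; rewrite !linearZ; congr (_ *: _).
apply/ffunP => m; rewrite ffunE (bigD1 n)//= big1 => [|k kn].
  by rewrite addr0 ffunE eqxx mulr1.
by rewrite ffunE (negbTE kn) mulr0.
Qed.

Lemma does_matrix_recoveryP (I : finType) (psi : I -> cvec R X) :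
  does_matrix_recovery psi <->
  forall a : X -> X -> R[i],
    (forall i, \sum_m \sum_n a m n * ((psi i n : R[i]) * (psi i m : R[i])^*) = 0) ->
    forall m n, a m n = 0.
Proof.
split=> [inj a a0 m n | ker A B /ffunP AB].
  have /lfunP/(_ [ffun k => (k == n)%:R])/ffunP/(_ m) :
    linfun (kernel_op_fun a) = 0.
    apply: inj; apply/ffunP => i; rewrite !ffunE !lfunE /= kernel_op_inner a0.
    by apply/esym/big1 => m' _; rewrite ffunE mul0r.
  rewrite !lfunE /= !ffunE (bigD1 n)//= big1 => [|k kn].
    by rewrite addr0 ffunE eqxx mulr1.
  by rewrite ffunE (negbTE kn) mulr0.
apply/lfunP => f; apply/eqP; rewrite -subr_eq0 -opp_lfunE -add_lfunE -kernel_ofK.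
apply/eqP/ffunP => m; rewrite !ffunE big1// => n _.
rewrite ker ?mul0r// => i; rewrite -kernel_op_inner kernel_ofK.
have := AB i; rewrite !ffunE => /eqP; rewrite -subr_eq0 -sumrB => /eqP <-.
by apply: eq_bigr => x _; rewrite add_lfunE opp_lfunE !ffunE mulrBl.
Qed.

End MatrixRecovery.

(** * Characters and correlations on the unit group *)

Section Characters.
Variables (R : realType) (p : nat).
Implicit Types (a f : Zpx p -> R[i]) (chi : Zpx p -> R[i]).

Lemma character1 chi : is_character chi -> chi 1%g = 1.
Proof.
move=> [chiM chi1]; have chi0 : chi 1%g != 0 by rewrite -normr_gt0 chi1.
by apply: (mulfI chi0); rewrite -chiM mulg1 mulr1.
Qed.

Lemma character_inv chi :
  is_character chi -> is_character (fun l => chi l^-1%g).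
Proof.
move=> [chiM chi1]; split=> [l l'|l]; last exact: chi1.
by rewrite invMg chiM mulrC.
Qed.

(** The unit group is cyclic, so the discrete logarithm to a generator turns the powers of a
    primitive root of unity into characters. The sums against these form a discrete Fourier
    transform, which is injective. *)
Lemma characters_total a :
  (forall chi, is_character chi -> \sum_m a m * chi m = 0) ->
  forall m, a m = 0.
Proof.
have /cyclicP[g gE] := field_unit_group_cyclic [group of [set: Zpx p]].
have ing x : x \in <[g]>%g by rewrite -gE inE.
pose N := #[g]%g; pose w : R[i] := expi (- (2 * trigo.pi / N%:R)).
have wN : N.-primitive_root w by exact/expi_prim_root/order_gt0.
pose log x : 'I_N := let: exist2 i iN _ := cyclePmin (ing x) in Ordinal iN.
have logK x : (g ^+ log x)%g = x by rewrite /log; case: cyclePmin.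
have expK (i : 'I_N) : log (g ^+ i)%g = i.
  have /eqP := logK (g ^+ i)%g.
  by rewrite eq_expg_mod_order !modn_small// => /eqP/val_inj.
move=> a0 m; rewrite -(logK m).
apply: (@dft_inj _ _ w (fun i => a (g ^+ i)%g) wN) => j.
pose chi x := w ^+ (log x * j).
have chiP : is_character chi.
  split=> [x y|x]; last by rewrite normrX normr_expi expr1n.
  rewrite -exprD -mulnDl /chi !exprM; congr (_ ^+ _); apply/eqP.
  by rewrite (eq_prim_root_expr wN) -eq_expg_mod_order expgD !logK.
rewrite -[RHS](a0 _ chiP) (reindex (fun i : 'I_N => g ^+ i)%g) /=.
  by apply: eq_bigr => i _; rewrite /chi expK.
by apply: onW_bij; exists log.
Qed.

(** Substituting [l * m^-1] for [l] separates the double sum, as in the convolution theorem; the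
    inverse in the first factor appears because this is a correlation. *)
Lemma correlation_character chi a f : is_character chi ->
  \sum_l chi l * (\sum_m a m * f (l * m)%g) =
  (\sum_m a m * chi m^-1%g) * \sum_l f l * chi l.
Proof.
move=> [chiM _]; under eq_bigr do rewrite mulr_sumr.
rewrite exchange_big mulr_suml; apply: eq_bigr => m _ /=.
rewrite (reindex_inj (mulIg m^-1%g)) mulr_sumr; apply: eq_bigr => l _.
by rewrite mulgKV chiM; ring.
Qed.

Lemma correlation_inj f :
  (forall chi, is_character chi -> \sum_l f l * chi l != 0) <->
  (forall a, (forall l, \sum_m a m * f (l * m)%g = 0) -> forall m, a m = 0).
Proof.
split=> [f0 a a0 | inj chi chiP].
  apply: characters_total => chi chiP; have chiVP := character_inv chiP.
  apply: (mulIf (f0 _ chiVP)); rewrite mul0r.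
  have := correlation_character a f chiVP.
  under [in RHS]eq_bigr do rewrite invgK.
  by move=> <-; rewrite big1// => l _; rewrite a0 mulr0.
(* If the coefficient vanished, [chi] itself would be a nonzero vector with zero correlation with
   [f]: shifting by [l] only multiplies the sum by [chi l^-1]. *)
apply/eqP => f0; suff /eqP : chi 1%g = 0 by rewrite character1// oner_eq0.
apply: inj => l.
transitivity (chi l^-1%g * \sum_m f m * chi m); last by rewrite f0 mulr0.
rewrite (reindex_inj (mulgI l^-1%g)) /= mulr_sumr.
by apply: eq_bigr => m _; rewrite mulKVg chiP.1; ring.
Qed.

(** Replacing l by -l pulls out the factor chi(-1), which has modulus 1. *)
Lemma c_coef_neq0 (phi : cvec R (Zpx p)) :
  (forall chi, is_character chi -> c_coef phi chi != 0) <->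
  (forall chi, is_character chi ->
     \sum_l ((phi l : R[i]) * (phi l : R[i])^*) * chi l != 0).
Proof.
have negK : involutive (@neg_unit p).
  by move=> l; apply: val_inj; rewrite /= opprK.
have cE chi : is_character chi -> c_coef phi chi =
    chi (neg_unit 1%g) * \sum_l ((phi l : R[i]) * (phi l : R[i])^*) * chi l.
  move=> [chiM _]; rewrite /c_coef (reindex_inj (inv_inj negK)) mulr_sumr.
  apply: eq_bigr => l _; rewrite negK normCK mulrCA -chiM; congr (_ * chi _).
  by apply: val_inj; rewrite /= mulN1r.
have chi0 chi : is_character chi -> chi (neg_unit 1%g) != 0.
  by move=> [_ chi1]; rewrite -normr_gt0 chi1.
split=> f0 chi chiP; have := f0 _ chiP.
  by rewrite cE// mulf_eq0 negb_or => /andP[].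
by rewrite cE// mulf_eq0 negb_or chi0.
Qed.

End Characters.

(** * Left inverses and trivial null spaces *)

Lemma left_inverse_kerP (F : fieldType) (I J : finType) (M : I -> J -> F) :
  (exists Bd, Bd *m (\matrix_(i < #|I|, j < #|J|) M (enum_val i) (enum_val j)) = 1%:M) <->
  (forall x : J -> F, (forall i, \sum_j x j * M i j = 0) -> forall j, x j = 0).
Proof.
set B := (\matrix_(_, _) _).
have mulBE (x : 'cV_#|J|) i :
    (B *m x) (enum_rank i) 0 = \sum_j x (enum_rank j) 0 * M i j.
  rewrite mxE [RHS](reindex (@enum_val J J)) /=; last first.
    exact/onW_bij/enum_val_bij.
  by apply: eq_bigr => j _; rewrite mxE enum_rankK enum_valK mulrC.
split=> [[Bd BdB] x x0 j | ker].
  have : (\col_j x (enum_val j)) = 0 :> 'cV_#|J|.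
    have Bx : B *m (\col_j x (enum_val j)) = 0.
      apply/colP => i; rewrite -(enum_valK i) mulBE mxE -[RHS](x0 (enum_val i)).
      by apply: eq_bigr => k _; rewrite mxE enum_rankK.
    by rewrite -[LHS]mul1mx -BdB -mulmxA Bx mulmx0.
  by move=> /colP/(_ (enum_rank j)); rewrite !mxE enum_rankK.
(* [B] annihilates every column of [cokermx B], so by hypothesis these columns are zero and [B] has
   full column rank. *)
apply/row_fullP; rewrite -cokermx_eq0; apply/eqP/matrixP => j k; rewrite [RHS]mxE.
rewrite -(enum_valK j); apply: (ker (fun j => cokermx B (enum_rank j) k)) => i.
transitivity ((B *m col k (cokermx B)) (enum_rank i) 0).
  by rewrite mulBE; apply: eq_bigr => j1 _; rewrite [in RHS]mxE.
by rewrite colE mulmxA mulmx_coker mul0mx mxE.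
Qed.

(** * Orbits of the affine group *)

Section AffineOrbit.
Variables (R : realType) (p : nat).
Hypothesis p_prime : prime p.
Implicit Types (phi : cvec R (Zpx p)) (a : Zpx p -> Zpx p -> R[i]).

Let w : R[i] := expi (- (2 * trigo.pi / p%:R)).
Let wp : p.-primitive_root w := expi_prim_root R (prime_gt0 p_prime).

Lemma hpi0_mul_conj phi (k : 'F_p) (l m n : Zpx p) :
  (hpi0 ((k, l) : affine p) phi n : R[i]) * (hpi0 ((k, l) : affine p) phi m : R[i])^*
  = ((phi (l * n)%g : R[i]) * (phi (l * m)%g : R[i])^*)
    * w ^+ ((val n - val m)%R * k)%N.
Proof.
rewrite !ffunE /= !expi_natE -/w rmorphM /=.
set x : R[i] := phi _; set y : R[i] := phi _.
(* Subtraction in ['F_p] changes the exponent by a multiple of p only, which is harmless since [w]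
   has order p. *)
have -> : w ^+ (k * val n)%N = w ^+ ((val n - val m)%R * k)%N * w ^+ (k * val m)%N.
  rewrite mulnC [(k * _)%N]mulnC !exprM -exprMn -exprD; congr (_ ^+ _); apply/eqP.
  rewrite (eq_prim_root_expr wp); apply/eqP.
  rewrite -[in LHS](subrK (val m) (val n)) /=.
  by rewrite [X in (_ %% X)%N = _ %[mod _]](Fp_cast p_prime) modn_mod.
have wJ : w ^+ (k * val m)%N * (w ^+ (k * val m)%N)^* = 1.
  by rewrite -normCK normrX normr_expi !expr1n.
by rewrite -[RHS]mulr1 -wJ; ring.
Qed.

Lemma orbit_annihilatorE phi a :
  (forall g : affine p, \sum_m \sum_n
     a m n * ((hpi0 g phi n : R[i]) * (hpi0 g phi m : R[i])^*) = 0) <->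
  (forall (d : 'F_p) l, \sum_m \sum_(n | val n - val m == d)
     a m n * ((phi (l * n)%g : R[i]) * (phi (l * m)%g : R[i])^*) = 0).
Proof.
pose H l (d : 'F_p) := \sum_m \sum_(n | val n - val m == d)
     a m n * ((phi (l * n)%g : R[i]) * (phi (l * m)%g : R[i])^*).
have HE k l : \sum_m \sum_n a m n * ((hpi0 ((k, l) : affine p) phi n : R[i])
    * (hpi0 ((k, l) : affine p) phi m : R[i])^*) = \sum_d H l d * w ^+ (d * k)%N.
  under [RHS]eq_bigr do rewrite mulr_suml.
  rewrite [RHS]exchange_big; apply: eq_bigr => m _ /=.
  rewrite (partition_big (fun n : Zpx p => val n - val m) predT)//=.
  apply: eq_bigr => d _; rewrite mulr_suml; apply: eq_bigr => n /eqP <-.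
  by rewrite hpi0_mul_conj mulrA.
split=> [a0 d l | a0 [k l]]; last by rewrite HE big1// => d _; rewrite /H a0 mul0r.
apply: (@dft_inj _ _ w (H l)) => [|k]; first by rewrite Fp_cast.
by rewrite -HE.
Qed.

Lemma sum_subdiagonal (V : nmodType) (F : Zpx p -> Zpx p -> V) (u : Zpx p) :
  \sum_m \sum_(n | val n - val m == - val u) F m n =
  \sum_(c : colidx p) F (u * succ_unit c)%g (u * val c)%g.
Proof.
rewrite pair_big_dep /=.
pose h (c : colidx p) := (u * succ_unit c, u * val c)%g.
(* The inverse of [h] is partial: only on the diagonal m - n = u is [u^-1 * n] sure to lie in
   [colidx], because its successor is then the unit [u^-1 * m]. *)
pose h' (q : Zpx p * Zpx p) : option (colidx p) := insub (u^-1 * q.2)%g.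
rewrite (reindex_omap h h') => [|[m n] /= /eqP nm].
  apply: eq_big => // c; rewrite /h' /= mulKg valK eqxx andbT.
  by rewrite mulrDr mulr1 opprD addNKr eqxx.
have um : val (u^-1 * n)%g + 1 = val (u^-1 * m)%g.
  rewrite /= -[X in _ + X](mulVr (valP u)) -mulrDr; congr (_ * _).
  by rewrite -[val u]opprK -nm opprB addrC subrK.
have cP : val (u^-1 * n)%g + 1 \is a GRing.unit by rewrite um; apply: valP.
rewrite /h' /= insubT /=; congr Some; congr pair; last by rewrite mulKVg.
apply: val_inj; rewrite /= -[X in _ * X]/(val (u^-1 * n)%g + 1) um /=.
by rewrite mulVKr// (valP u).
Qed.

(** Since l runs over the whole group, replacing it by [l * u^-1] removes u from the arguments of
    [phi]. All diagonals off the main one thus obey the same linear system, so a single matrix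
    governs them. *)
Lemma orbit_annihilator_diagonals phi a :
  (forall g : affine p, \sum_m \sum_n
     a m n * ((hpi0 g phi n : R[i]) * (hpi0 g phi m : R[i])^*) = 0) <->
  (forall l, \sum_m a m m * ((phi (l * m)%g : R[i]) * (phi (l * m)%g : R[i])^*) = 0) /\
  (forall u l, \sum_(c : colidx p) a (u * succ_unit c)%g (u * val c)%g *
     ((phi (l * val c)%g : R[i]) * (phi (l * succ_unit c)%g : R[i])^*) = 0).
Proof.
have diagE (F : Zpx p -> Zpx p -> R[i]) :
    \sum_m \sum_(n | val n - val m == 0) F m n = \sum_m F m m.
  by apply: eq_bigr => m _; apply: big_pred1 => n; rewrite subr_eq0.
rewrite orbit_annihilatorE; split=> [a0 | [a0 a1] d l].
  split=> [l | u l]; first by rewrite -[RHS](a0 0 l) diagE.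
  rewrite -[RHS](a0 (- val u) (l * u^-1)%g) sum_subdiagonal.
  by apply: eq_bigr => c _; rewrite !mulgA !mulgKV.
have [->|d0] := eqVneq d 0; first by rewrite diagE.
have uP : - d \is a GRing.unit by rewrite unitfE oppr_eq0.
rewrite -[d]opprK -[- d]/(val (FinRing.Unit uP)) sum_subdiagonal.
set u := FinRing.Unit uP; rewrite -[RHS](a1 u (l * u)%g).
by apply: eq_bigr => c _; rewrite !mulgA.
Qed.

Lemma hpi0_matrix_recoveryP phi :
  does_matrix_recovery (fun g : affine p => hpi0 g phi) <->
  (forall b : Zpx p -> R[i],
     (forall l, \sum_m b m * ((phi (l * m)%g : R[i]) * (phi (l * m)%g : R[i])^*) = 0) ->
     forall m, b m = 0) /\
  (forall x : colidx p -> R[i],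
     (forall l, \sum_(c : colidx p) x c *
        ((phi (l * val c)%g : R[i]) * (phi (l * succ_unit c)%g : R[i])^*) = 0) ->
     forall c, x c = 0).
Proof.
rewrite does_matrix_recoveryP; split=> [ker | [kerD kerS] a].
  split=> [b b0 m | x x0 c].
    pose a (m n : Zpx p) := if m == n then b m else 0.
    suff : a m m = 0 by rewrite /a eqxx.
    apply: ker; apply/orbit_annihilator_diagonals; split=> [l | u l].
      by rewrite -[RHS](b0 l); apply: eq_bigr => k _; rewrite /a eqxx.
    apply: big1 => c _; rewrite /a [_ == _](_ : _ = false) ?mul0r//.
    apply/negbTE/eqP => /mulgI/(congr1 val)/=/eqP.
    by rewrite -subr_eq0 addrC addKr oner_eq0.
  (* [x] is placed on the diagonal u = 1, the only one meeting this support, since u(c + 1) = uc + 1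
     forces u = 1. The default 0 is never reached: [val m = val n + 1] with [m] a unit puts [n] in
     [colidx]. *)
  pose a (m n : Zpx p) :=
    if val m == val n + 1 then oapp x 0 (insub n : option (colidx p)) else 0.
  suff : a (succ_unit c) (val c) = 0 by rewrite /a /= eqxx valK.
  apply: ker; apply/orbit_annihilator_diagonals; split=> [l | u l].
    apply: big1 => m _; rewrite /a [_ == _](_ : _ = false) ?mul0r//.
    by rewrite -subr_eq0 opprD addNKr oppr_eq0 oner_eq0.
  have [->|u1] := eqVneq u 1%g.
    by rewrite -[RHS](x0 l); apply: eq_bigr => d _; rewrite /a !mul1g eqxx valK.
  apply: big1 => d _; rewrite /a [_ == _](_ : _ = false) ?mul0r//=.
  by apply: contraNF u1; rewrite mulrDr mulr1 => /eqP/addrI uE; apply/eqP/val_inj.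
move=> /orbit_annihilator_diagonals[a0 a1] m n.
have [->|mn] := eqVneq m n; first exact: (kerD (fun m => a m m)).
(* The entry (m, n) lies on the diagonal u = m - n, at position c = n/u, where c + 1 = m/u. *)
have uP : val m - val n \is a GRing.unit by rewrite unitfE subr_eq0.
pose u : Zpx p := FinRing.Unit uP.
have um : val (u^-1 * n)%g + 1 = val (u^-1 * m)%g.
  rewrite /= -[X in _ + X](mulVr uP) -mulrDr; congr (_ * _).
  by rewrite addrC subrK.
have cP : val (u^-1 * n)%g + 1 \is a GRing.unit by rewrite um; apply: valP.
pose c : colidx p := exist _ (u^-1 * n)%g cP.
have := kerS (fun c => a (u * succ_unit c)%g (u * val c)%g) (a1 u) c.
have -> : succ_unit c = (u^-1 * m)%g by apply: val_inj; rewrite -um.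
by rewrite /= !mulKVg.
Qed.

End AffineOrbit.

Theorem theorem6p5 (R : realType) (p : nat) (hp : prime p) (hp2 : (2 < p)%N)
    (phi : cvec R (Zpx p)) :
  does_matrix_recovery (fun g : affine p => hpi0 g phi) <->
  ((forall chi : Zpx p -> R[i], is_character chi -> c_coef phi chi != 0) /\
   (exists Bd : 'M[R[i]]_(#|{: colidx p}|, #|{: Zpx p}|),
      Bd *m B_mx phi = 1%:M)).
Proof.
rewrite hpi0_matrix_recoveryP// c_coef_neq0.
rewrite (correlation_inj (fun l => (phi l : R[i]) * (phi l : R[i])^*)).
by rewrite -(left_inverse_kerP
  (fun m (c : colidx p) => (phi (m * val c)%g : R[i]) * (phi (m * succ_unit c)%g : R[i])^*)).
Qed.
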